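(* Let $q\in\mathbb{K}$ with $q\neq 0$, let $z\in\mathbb{K}$, and let $W$ be the $\mathbb{K}$-vector space with basis $\{Q_n,R_n\}_{n\in\mathbb{Z}}$. Let $[\cdot,\cdot,\cdot]_q:W\times W\times W\to W$ be the skew-symmetric trilinear bracket determined, for all $k,m,n\in\mathbb{Z}$, by $$[Q_k,Q_m,Q_n]_q=q^{k+m+n}(k-m)(m-n)(k-n)R_{k+m+n},$$ $$[Q_k,Q_m,R_n]_q=q^{k+m+n}(k-m)(Q_{k+m+n}+z\,n\,R_{k+m+n}),$$ $$[Q_k,R_m,R_n]_q=q^{k+m+n}(n-m)R_{k+m+n},$$ $$[R_k,R_m,R_n]_q=0.$$ Let $\alpha_1,\alpha_2:W\to W$ be the linear maps given by $$\alpha_1(Q_n)=q^nQ_n,\quad \alpha_1(R_n)=q^nR_n,\qquad \alpha_2(Q_n)=q^nQ_n,\quad \alpha_2(R_n)=q^nR_n\qquad(n\in\mathbb{Z}).$$ If $z=\pm 2i$, then $(W,[\cdot,\cdot,\cdot]_q,(\alpha_1,\alpha_2))$ is a ternary Hom-Nambu-Lie algebra.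
   Context: $\mathbb{K}$ is an algebraically closed field of characteristic zero and $i\in\mathbb{K}$ denotes a square root of $-1$. A ternary Hom-Nambu-Lie algebra is a triple $(V,[\cdot,\cdot,\cdot],(\alpha_1,\alpha_2))$ consisting of a $\mathbb{K}$-vector space $V$, a trilinear map $[\cdot,\cdot,\cdot]:V\times V\times V\to V$ which is skew-symmetric, i.e. $[x_{\sigma(1)},x_{\sigma(2)},x_{\sigma(3)}]=\mathrm{Sgn}(\sigma)[x_1,x_2,x_3]$ for all $\sigma\in\mathcal{S}_3$ and $x_1,x_2,x_3\in V$, and linear maps $\alpha_1,\alpha_2:V\to V$, satisfying the Hom-Nambu identity: for all $x_1,\dots,x_5\in V$, $$[\alpha_1(x_1),\alpha_2(x_2),[x_3,x_4,x_5]]=[[x_1,x_2,x_3],\alpha_1(x_4),\alpha_2(x_5)]+[\alpha_1(x_3),[x_1,x_2,x_4],\alpha_2(x_5)]+[\alpha_1(x_3),\alpha_2(x_4),[x_1,x_2,x_5]].$$ *)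

(* Defs.v *)
From mathcomp Require Import all_boot all_order all_algebra all_fingroup.

Set Implicit Arguments.
Unset Strict Implicit.
Unset Printing Implicit Defensive.

Import GRing.Theory.
Local Open Scope ring_scope.

Section Ternary.
Variables (K : fieldType) (V : lmodType K).
Implicit Types (br : V -> V -> V -> V).

Record trilinear br : Prop := Trilinear {
  trilinear1 : forall y z, linear (fun x => br x y z);
  trilinear2 : forall x z, linear (fun y => br x y z);
  trilinear3 : forall x y, linear (fun z => br x y z) }.

(* In 'I_3 the numerals 0, 1, 2 are the three indices; s : 'S_3 coerces to the
   boolean "s is odd", so (-1) ^+ s is the signature of s. *)
Definition skew_symmetric br : Prop :=
  forall (s : 'S_3) (x : 'I_3 -> V),
    br (x (s 0)) (x (s 1)) (x (s 2)) = (-1) ^+ s *: br (x 0) (x 1) (x 2).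

Definition Hom_Nambu_identity br (a1 a2 : V -> V) : Prop :=
  forall x1 x2 x3 x4 x5 : V,
    br (a1 x1) (a2 x2) (br x3 x4 x5) =
      br (br x1 x2 x3) (a1 x4) (a2 x5)
    + br (a1 x3) (br x1 x2 x4) (a2 x5)
    + br (a1 x3) (a2 x4) (br x1 x2 x5).

Record ternary_Hom_Nambu_Lie br (a1 a2 : V -> V) : Prop := TernaryHomNambuLie {
  thnl_trilinear : trilinear br;
  thnl_skew : skew_symmetric br;
  thnl_linear1 : linear a1;
  thnl_linear2 : linear a2;
  thnl_identity : Hom_Nambu_identity br a1 a2 }.

End Ternary.

Section Basis.
Variables (K : fieldType) (V : lmodType K) (I : eqType).
Implicit Type b : I -> V.

Definition free_family b : Prop :=
  forall (s : seq I) (c : I -> K), uniq s ->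
    \sum_(i <- s) c i *: b i = 0 -> {in s, forall i, c i = 0}.

Definition spanning_family b : Prop :=
  forall v : V, exists (s : seq I) (c : I -> K), v = \sum_(i <- s) c i *: b i.

Definition basis_family b : Prop := free_family b /\ spanning_family b.

End Basis.

Section QBracket.
Variables (K : fieldType) (W : lmodType K).

(* The family indexed by the disjoint union of two copies of the integers. *)
Definition joint_family (Q R : int -> W) (u : int + int) : W :=
  match u with inl n => Q n | inr n => R n end.

Record q_bracket (q z : K) (Q R : int -> W) (br : W -> W -> W -> W) : Prop :=
  QBracket {
  qb_trilinear : trilinear br;
  qb_skew : skew_symmetric br;
  qb_QQQ : forall k m n : int,
    br (Q k) (Q m) (Q n) =
      (q ^ (k + m + n) * (k - m)%:~R * (m - n)%:~R * (k - n)%:~R)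
        *: R (k + m + n);
  qb_QQR : forall k m n : int,
    br (Q k) (Q m) (R n) =
      (q ^ (k + m + n) * (k - m)%:~R)
        *: (Q (k + m + n) + (z * n%:~R) *: R (k + m + n));
  qb_QRR : forall k m n : int,
    br (Q k) (R m) (R n) =
      (q ^ (k + m + n) * (n - m)%:~R) *: R (k + m + n);
  qb_RRR : forall k m n : int, br (R k) (R m) (R n) = 0 }.

Definition q_twist (q : K) (Q R : int -> W) (a : W -> W) : Prop :=
  [/\ linear a,
      forall n : int, a (Q n) = q ^ n *: Q n
    & forall n : int, a (R n) = q ^ n *: R n].

End QBracket.

(* The structure constants above do define a bracket, and likewise the twisting
   maps exist: [q_bracket] and [q_twist] are satisfiable over every basis. *)
Section Existence.
Variables (K : fieldType) (V : lmodType K) (I : choiceType) (b : I -> V).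
Hypothesis basis_b : basis_family b.

Let comb (U : lmodType K) (f : I -> U) (l : seq (K * I)) : U :=
  \sum_(p <- l) p.1 *: f p.2.

Lemma exists_comb (v : V) : exists l : seq (K * I), v == comb b l.
Proof.
have [s [c ->]] := basis_b.2 v.
by exists [seq (c i, i) | i <- s]; rewrite /comb big_map.
Qed.

Let coords v := xchoose (exists_comb v).

Let coordsK v : comb b (coords v) = v.
Proof. exact/esym/eqP/(xchooseP (exists_comb v)). Qed.

Let combE (U : lmodType K) (f : I -> U) l :
  comb f l = \sum_(i <- undup (map snd l))
               (\sum_(p <- l | p.2 == i) p.1) *: f i.
Proof.
rewrite /comb; under [RHS]eq_bigr do rewrite scaler_suml.
rewrite (exchange_big_dep xpredT) //= big_seq [RHS]big_seq.
apply: eq_bigr => p pl.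
have pu : p.2 \in undup (map snd l) by rewrite mem_undup map_f.
rewrite -big_filter (_ : [seq i <- _ | _] = [:: p.2]) ?big_seq1 //.
rewrite (eq_filter (a2 := pred1 p.2)) => [|i]; last exact: eq_sym.
by rewrite filter_pred1_uniq ?undup_uniq.
Qed.

Let comb0 (U : lmodType K) (f : I -> U) l : comb b l = 0 -> comb f l = 0.
Proof.
rewrite !combE => /(basis_b.1 _ _ (undup_uniq _)) c0.
by rewrite big_seq big1 // => i /c0 ->; rewrite scale0r.
Qed.

Definition extend (U : lmodType K) (f : I -> U) (v : V) : U := comb f (coords v).

Let scale_comb (a : K) (l : seq (K * I)) := [seq (a * p.1, p.2) | p <- l].

Let comb_scale (U : lmodType K) (f : I -> U) a l :
  comb f (scale_comb a l) = a *: comb f l.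
Proof.
by rewrite /comb big_map scaler_sumr; apply: eq_bigr => p _; rewrite scalerA.
Qed.

Let comb_cat (U : lmodType K) (f : I -> U) l1 l2 :
  comb f (l1 ++ l2) = comb f l1 + comb f l2.
Proof. exact: big_cat. Qed.

Let extend_comb (U : lmodType K) (f : I -> U) v l :
  v = comb b l -> extend f v = comb f l.
Proof.
move=> vE; apply/eqP; rewrite -subr_eq0 -scaleN1r -comb_scale -comb_cat.
by apply/eqP/comb0; rewrite comb_cat comb_scale coordsK vE scaleN1r subrr.
Qed.

Lemma extend_linear (U : lmodType K) (f : I -> U) : linear (extend f).
Proof.
move=> a u v; rewrite (@extend_comb _ _ _ (scale_comb a (coords u) ++ coords v)).
  by rewrite comb_cat comb_scale.
by rewrite comb_cat comb_scale !coordsK.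
Qed.

Lemma extend_basis (U : lmodType K) (f : I -> U) i : extend f (b i) = f i.
Proof.
by rewrite (@extend_comb _ _ _ [:: (1, i)]) /comb big_seq1 scale1r.
Qed.

Lemma extend_sum (U : lmodType K) (f g : I -> U) a v :
  extend (fun i => a *: f i + g i) v = a *: extend f v + extend g v.
Proof.
rewrite /extend /comb scaler_sumr -big_split; apply: eq_bigr => p _ /=.
by rewrite scalerDr !scalerA mulrC.
Qed.

Lemma eq_extend (U : lmodType K) (f g : I -> U) v :
  f =1 g -> extend f v = extend g v.
Proof. by move=> fg; apply: eq_bigr => p _; rewrite fg. Qed.

Lemma linear_eq0 (U : lmodType K) (f : V -> U) :
  linear f -> (forall i, f (b i) = 0) -> forall v, f v = 0.
Proof.
move=> lf f0 v; rewrite -(coordsK v) /comb.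
have f00 : f 0 = 0 by have := lf (-1) 0 0; rewrite scaler0 addr0 scaleN1r addNr.
elim: (coords v) => [|p l IH]; first by rewrite big_nil.
by rewrite big_cons lf f0 scaler0 add0r.
Qed.

Definition extend3 (T : I -> I -> I -> V) (x y z : V) : V :=
  extend (fun i => extend (fun j => extend (T i j) z) y) x.

Lemma extend3_trilinear T : trilinear (extend3 T).
Proof.
split=> [y z|x z|x y].
- exact: extend_linear.
- move=> a u v; rewrite -extend_sum.
  by apply: eq_extend => i; rewrite extend_linear.
- move=> a u v; rewrite -extend_sum; apply: eq_extend => i.
  by rewrite -extend_sum; apply: eq_extend => j; rewrite extend_linear.
Qed.

Lemma extend3_basis T i j k : extend3 T (b i) (b j) (b k) = T i j k.
Proof. by rewrite /extend3 !extend_basis. Qed.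

Lemma trilinear_eq0 f : trilinear f ->
  (forall i j k, f (b i) (b j) (b k) = 0) -> forall x y z : V, f x y z = 0.
Proof.
case=> l1 l2 l3 f0 x y z; apply: (linear_eq0 (l1 y z)) => i.
by apply: (linear_eq0 (l2 _ z)) => j; apply: (linear_eq0 (l3 _ _)).
Qed.

Lemma skew_of_swaps (f : V -> V -> V -> V) :
  (forall x y z, f y x z = - f x y z) -> (forall x y z, f x z y = - f x y z) ->
  skew_symmetric f.
Proof.
move=> f12 f23.
pose P (s : 'S_3) := forall x : 'I_3 -> V,
  f (x (s 0)) (x (s 1)) (x (s 2)) = (-1) ^+ s *: f (x 0) (x 1) (x 2).
have f13 x y z : f z y x = - f x y z by rewrite f12 f23 f12 opprK.
have Pt i j (s : 'S_3) : i != j -> P s -> P (tperm i j * s)%g.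
  move=> nij Ps x; rewrite odd_permM odd_tperm nij signr_addb expr1 mulN1r.
  rewrite scaleNr -Ps !permM.
  wlog lij: i j nij / (i < j)%N => [W|].
    have := nij; rewrite -val_eqE neq_ltn => /orP[]; first exact: W.
    by rewrite tpermC; apply: W; rewrite eq_sym.
  have [[-> ->]|[[-> ->]|[-> ->]]] :
      i = 0 /\ j = 1 \/ i = 1 /\ j = 2 \/ i = 0 /\ j = 2.
    by case: i j lij {nij} => [[|[|[|//]]] ?] [[|[|[|//]]] ?] //= _;
       [left | right; right | right; left]; split; apply: val_inj.
  - by rewrite tpermL tpermR tpermD.
  - by rewrite tpermL tpermR tpermD.
  - by rewrite tpermL tpermR tpermD.
move=> s; change (P s); have [ts -> ] := prod_tpermP s.
elim: ts => [|[i j] ts IH] /= => [_|/andP[nij /IH Pts]].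
  by rewrite big_nil => x; rewrite !perm1 odd_perm1 scale1r.
by rewrite big_cons; apply: Pt.
Qed.

Lemma skew_on_basis (f : V -> V -> V -> V) : trilinear f ->
  (forall i j k, f (b j) (b i) (b k) = - f (b i) (b j) (b k)) ->
  (forall i j k, f (b i) (b k) (b j) = - f (b i) (b j) (b k)) ->
  skew_symmetric f.
Proof.
move=> lf f12 f23; have [l1 l2 l3] := lf.
apply: skew_of_swaps => x y z; apply/eqP; rewrite -addr_eq0; apply/eqP.
- apply: (@trilinear_eq0 (fun x y z => f y x z + f x y z)) => [|i j k].
    split=> [y' z'|x' z'|x' y'] a u v; rewrite ?l1 ?l2 ?l3 scalerDr;
    exact: addrACA.
  by rewrite f12 addNr.
- apply: (@trilinear_eq0 (fun x y z => f x z y + f x y z)) => [|i j k].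
    split=> [y' z'|x' z'|x' y'] a u v; rewrite ?l1 ?l2 ?l3 scalerDr;
    exact: addrACA.
  by rewrite f23 addNr.
Qed.

End Existence.

Section Table.
Variables (W : zmodType) (A B C : int -> int -> int -> W).

Definition table (u v w : int + int) : W :=
  match u, v, w with
  | inl k, inl m, inl n => A k m n
  | inl k, inl m, inr n => B k m n
  | inl k, inr n, inl m => - B k m n
  | inr n, inl k, inl m => B k m n
  | inl k, inr m, inr n => C k m n
  | inr m, inl k, inr n => - C k m n
  | inr m, inr n, inl k => C k m n
  | inr _, inr _, inr _ => 0
  end.

Hypothesis A12 : forall k m n, A m k n = - A k m n.
Hypothesis A23 : forall k m n, A k n m = - A k m n.
Hypothesis B12 : forall k m n, B m k n = - B k m n.
Hypothesis C23 : forall k m n, C k n m = - C k m n.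

Lemma table12 u v w : table v u w = - table u v w.
Proof.
case: u v w => [k|k] [m|m] [n|n] /=;
  by [ | apply: A12 | apply: B12 | apply: C23 | rewrite opprK | rewrite oppr0].
Qed.

Lemma table23 u v w : table u w v = - table u v w.
Proof.
case: u v w => [k|k] [m|m] [n|n] /=;
  by [ | apply: A23 | apply: B12 | apply: C23 | rewrite opprK | rewrite oppr0].
Qed.

End Table.

Section Satisfiable.
Variables (K : fieldType) (W : lmodType K) (Q R : int -> W) (q z : K).
Hypothesis basisQR : basis_family (joint_family Q R).

Lemma q_bracket_exists : exists br, q_bracket q z Q R br.
Proof.
pose A (k m n : int) : W :=
  (q ^ (k + m + n) * (k - m)%:~R * (m - n)%:~R * (k - n)%:~R)
    *: R (k + m + n).
pose B (k m n : int) : W :=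
  (q ^ (k + m + n) * (k - m)%:~R)
    *: (Q (k + m + n) + (z * n%:~R) *: R (k + m + n)).
pose C (k m n : int) : W :=
  (q ^ (k + m + n) * (n - m)%:~R) *: R (k + m + n).
have swap (m n : int) : (n - m)%:~R = - (m - n)%:~R :> K.
  by rewrite -rmorphN opprB.
have A12 k m n : A m k n = - A k m n.
  rewrite /A (addrC m k) -scaleNr (swap k m) mulrN !mulNr.
  by congr (- _ *: _); apply: mulrAC.
have A23 k m n : A k n m = - A k m n.
  rewrite /A (addrAC k n m) -scaleNr (swap m n) mulrN mulNr.
  by congr (- _ *: _); rewrite -!mulrA; congr (_ * _); rewrite mulrCA mulrA mulrC.
have B12 k m n : B m k n = - B k m n.
  by rewrite /B (addrC m k) -scaleNr (swap k m) mulrN.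
have C23 k m n : C k n m = - C k m n.
  by rewrite /C (addrAC k n m) -scaleNr (swap n m) mulrN.
have tri := extend3_trilinear basisQR (table A B C).
have tE := extend3_basis basisQR (table A B C).
exists (extend3 basisQR (table A B C)); split=> // [|k m n|k m n|k m n|k m n].
- apply: (skew_on_basis basisQR tri) => u v w; rewrite !tE.
    exact: table12.
  exact: table23.
- exact: (tE (inl k) (inl m) (inl n)).
- exact: (tE (inl k) (inl m) (inr n)).
- exact: (tE (inl k) (inr m) (inr n)).
- exact: (tE (inr k) (inr m) (inr n)).
Qed.

Lemma q_twist_exists : exists a, q_twist q Q R a.
Proof.
pose f u := match u with inl n => q ^ n *: Q n | inr n => q ^ n *: R n end.
have fE := extend_basis basisQR f.
exists (extend basisQR f); split; first exact: extend_linear.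
- by move=> n; rewrite (fE (inl n)).
- by move=> n; rewrite (fE (inr n)).
Qed.

End Satisfiable.

(* Main.v *)
Require Import Defs.
From mathcomp Require Import all_boot all_order all_algebra all_fingroup.
From mathcomp Require Import ring.

Import GRing.Theory.
Local Open Scope ring_scope.

(** Let [lam] be the square root of -1 with [z = 2 * lam], and replace [Q n] by
    [P n = Q n + lam * n R n]. In the basis [P], [R] the coefficient of [R] in a
    bracket of two [P]'s and one [R] becomes a multiple of [z - 2 * lam], and the
    bracket of three [P]'s a multiple of [1 + lam * z - lam ^+ 2], that is of
    [1 + lam ^+ 2]. So both vanish, and up to the powers of [q] what is left is
      [P k, P m, P n] = 0,              [P k, P m, R n] = (k - m) P (k + m + n),
      [P k, R m, R n] = (n - m) R (k + m + n),               [R k, R m, R n] = 0.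

    Give [P] weight 1 and [R] weight 0. The structure constant of the bracket of
    elements of weights a, b, c and degrees k, m, n is then, in every case, the
    determinant [weight_det] of the vectors (1, a, k), (1, b, m), (1, c, n) (up
    to a sign), and the result has weight a + b + c - 1 and degree k + m + n
    ([bracket_homog_weight]). This is the law, up to sign, of the monomials
    f = u^a t^k under u^-1 times the determinant with rows f, u df/du, t df/dt, a
    Nambu bracket. A weight a + b + c - 1 other than 0 or 1 occurs only when the three
    weights are equal, and then the determinant is zero.

    For such a bracket all four terms of the Hom-Nambu identity are multiples of
    the same homogeneous element, with the same power of [q] because twists and
    brackets are graded ([bracket_nested]). The identity reduces to one between
    determinants ([weight_det_Cramer]): it follows from Cramer's rule
      det (v3, v4, v5) y = det (y, v4, v5) v3 + det (v3, y, v5) v4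
                         + det (v3, v4, y) v5
    under the linear form det (v1, v2, _), with y = v1 + v2 + v3 + v4 + v5 - w,
    where w = (2, 1, 0) corrects the first coordinate and the weight. Linearity
    then extends it from homogeneous elements to the whole space. *)

(** * The determinant of weights and degrees *)

(** Minus the determinant of the vectors (1, a, k), (1, b, m), (1, c, n). *)
Definition weight_det {K : fieldType} (a k b m c n : K) : K :=
  a * (n - m) + b * (k - n) + c * (m - k).

(** A bracket of weights c, d, e has weight c + d + e - 1; for these weights the
    identity is Cramer's rule for (1, c, m), (1, d, n), (1, e, p), evaluated by
    the form det ((1, a, k), (1, b, l), _). *)
Lemma weight_det_Cramer {K : fieldType} (a b c d e k l m n p : K) :
  weight_det c m d n e p * weight_det a k b l (c + d + e - 1) (m + n + p) =
    weight_det a k b l c m * weight_det d n e p (a + b + c - 1) (k + l + m)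
  + weight_det a k b l d n * weight_det e p c m (a + b + d - 1) (k + l + n)
  + weight_det a k b l e p * weight_det c m d n (a + b + e - 1) (k + l + p).
Proof. by rewrite /weight_det; ring. Qed.

(** Equal to a + b + c - 1 when that is 0 or 1, but always a valid weight, so that
    a bracket of generators can be an argument of another bracket. *)
Definition majority (a b c : bool) : bool := (1 < a + b + c)%N.

(** The majority of three weights is their sum minus 1 unless they are all equal,
    and in that case the determinant has two proportional columns. This makes the
    weight of a bracket polynomial in the weights of its arguments. *)
Lemma weight_det_majority {K : fieldType} (a b c : bool) (k m n : K) :
  weight_det a%:R k b%:R m c%:R n * (majority a b c)%:R =
  weight_det a%:R k b%:R m c%:R n * (a%:R + b%:R + c%:R - 1).
Proof. by rewrite /weight_det; case: a b c => [] [] [] /=; ring. Qed.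

(** * Skew-symmetric brackets *)

Lemma skew_swap12 {K : fieldType} {V : lmodType K} {br : V -> V -> V -> V} :
  skew_symmetric br -> forall x y z, br y x z = - br x y z.
Proof.
move=> sk x y z; have := sk (tperm 0 1) (fun j => [:: x; y; z]`_j).
by rewrite tpermL tpermR tpermD // odd_tperm /= expr1 scaleN1r.
Qed.

Lemma skew_swap23 {K : fieldType} {V : lmodType K} {br : V -> V -> V -> V} :
  skew_symmetric br -> forall x y z, br x z y = - br x y z.
Proof.
move=> sk x y z; have := sk (tperm 1 2) (fun j => [:: x; y; z]`_j).
by rewrite tpermL tpermR tpermD // odd_tperm /= expr1 scaleN1r.
Qed.

Lemma skew_rot {K : fieldType} {V : lmodType K} {br : V -> V -> V -> V} :
  skew_symmetric br -> forall x y z, br x y z = br y z x.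
Proof.
by move=> sk x y z; rewrite (skew_swap12 sk y x) (skew_swap23 sk y z) opprK.
Qed.

(** * Homogeneous elements *)

(** The line through [R n] (at [e = 0]) and the shifted generator
    [P n = Q n + lam * n R n] (at [e = 1]). Allowing every scalar [e] as weight
    lets one write brackets of weight a + b + c - 1 without a case distinction. *)
Definition homog {K : fieldType} {W : lmodType K} (lam : K) (Q R : int -> W)
    (e : K) (n : int) : W :=
  e *: (Q n + (lam * n%:~R) *: R n) + (1 - e) *: R n.

(** The elements of weights 0 and 1 span: [Q n = P n - lam * n R n]. *)
Lemma linear_eq_homog {K : fieldType} {W : lmodType K} (lam : K)
    {Q R : int -> W} {f g : W -> W} :
  basis_family (joint_family Q R) -> linear f -> linear g ->
  (forall (b : bool) n, f (homog lam Q R b%:R n) = g (homog lam Q R b%:R n)) ->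
  forall v, f v = g v.
Proof.
move=> bas lf lg fg v; apply/eqP; rewrite -subr_eq0; apply/eqP; move: v.
have lh : linear (fun v => f v - g v).
  by move=> a u v; rewrite lf lg opprD addrACA -scalerBr.
have hR n : f (R n) - g (R n) = 0.
  have := fg false n.
  by rewrite /homog scale0r add0r subr0 scale1r => ->; rewrite subrr.
apply: (linear_eq0 bas lh) => -[] n //=.
have := fg true n; rewrite /homog subrr scale0r addr0 scale1r addrC.
by move/eqP; rewrite -subr_eq0 [_ - _]lh hR scaler0 add0r => /eqP.
Qed.

Lemma twist_homog {K : fieldType} {W : lmodType K} {q lam : K} {Q R : int -> W}
    {alpha : W -> W} (e : K) (n : int) :
  q_twist q Q R alpha ->
  alpha (homog lam Q R e n) = q ^ n *: homog lam Q R e n.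
Proof.
case=> lin aQ aR.
have a0 : alpha 0 = 0 by have := lin (-1) 0 0; rewrite scaler0 addr0 scaleN1r addNr.
have aZ a u : alpha (a *: u) = a *: alpha u by rewrite -[a *: u]addr0 lin a0 addr0.
rewrite /homog lin [Q n + _]addrC lin !aZ aQ aR !scalerDr !scalerA.
by congr (_ + _ + _); congr (_ *: _); ring.
Qed.

(** * The bracket in the shifted basis *)

Section Bracket.
Variables (K : fieldType) (W : lmodType K) (q lam z : K) (Q R : int -> W).
Variable br : W -> W -> W -> W.
Hypothesis q_neq0 : q != 0.
Hypothesis lam_sqr : lam ^+ 2 = -1.
Hypothesis z_def : z = 2 * lam.
Hypothesis br_def : q_bracket q z Q R br.

Let sk := qb_skew br_def.
Let tri := qb_trilinear br_def.
Local Notation H := (homog lam Q R).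

Let br1 a u v y w : br (a *: u + v) y w = a *: br u y w + br v y w.
Proof. by have [l _ _] := tri; exact: l. Qed.
Let br2 a u v x w : br x (a *: u + v) w = a *: br x u w + br x v w.
Proof. by have [_ l _] := tri; exact: l. Qed.
Let br3 a u v x y : br x y (a *: u + v) = a *: br x y u + br x y v.
Proof. by have [_ _ l] := tri; exact: l. Qed.
Let br10 y w : br 0 y w = 0.
Proof. by have := br1 (-1) 0 0 y w; rewrite scaler0 addr0 scaleN1r addNr. Qed.
Let br1Z a u y w : br (a *: u) y w = a *: br u y w.
Proof. by rewrite -[a *: u]addr0 br1 br10 addr0. Qed.
Let br3Z a u x y : br x y (a *: u) = a *: br x y u.
Proof. by rewrite -!(skew_rot sk _ x y) br1Z. Qed.
Let br2Z a u x w : br x (a *: u) w = a *: br x u w.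
Proof. by rewrite !(skew_rot sk x _ w) br1Z. Qed.

Let comb a b n : W := a *: Q n + b *: R n.

Let combD a b c d n : comb a b n + comb c d n = comb (a + c) (b + d) n.
Proof. by rewrite /comb !scalerDl addrACA. Qed.

Let combZ a b c n : a *: comb b c n = comb (a * b) (a * c) n.
Proof. by rewrite /comb scalerDr !scalerA. Qed.

Let brQQQ k m n : br (Q k) (Q m) (Q n) =
  comb 0 (q ^ (k + m + n) * (k%:~R - m%:~R) * (m%:~R - n%:~R) * (k%:~R - n%:~R))
    (k + m + n).
Proof. by rewrite (qb_QQQ br_def) /comb scale0r add0r !rmorphB. Qed.

Let brQQR k m n : br (Q k) (Q m) (R n) =
  comb (q ^ (k + m + n) * (k%:~R - m%:~R))
    (q ^ (k + m + n) * (k%:~R - m%:~R) * (z * n%:~R)) (k + m + n).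
Proof. by rewrite (qb_QQR br_def) /comb scalerDr scalerA rmorphB. Qed.

Let brQRR k m n : br (Q k) (R m) (R n) =
  comb 0 (q ^ (k + m + n) * (n%:~R - m%:~R)) (k + m + n).
Proof. by rewrite (qb_QRR br_def) /comb scale0r add0r rmorphB. Qed.

Let brRRR k m n : br (R k) (R m) (R n) = comb 0 0 (k + m + n).
Proof. by rewrite (qb_RRR br_def) /comb !scale0r addr0. Qed.

Let rot_add (k m n : int) : m + n + k = k + m + n.
Proof. by rewrite addrC addrA. Qed.

(** With the coordinates on [Q] and [R] as parameters, a change of generators in
    each degree becomes a substitution in polynomials. *)
Lemma bracket_comb a b c d e f k m n :
  br (comb a b k) (comb c d m) (comb e f n) =
  comb (q ^ (k + m + n) * (a * c * f * (k%:~R - m%:~R)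
           + c * e * b * (m%:~R - n%:~R) + e * a * d * (n%:~R - k%:~R)))
       (q ^ (k + m + n) * (a * c * e * (k%:~R - m%:~R) * (m%:~R - n%:~R)
                             * (k%:~R - n%:~R)
         + z * (a * c * f * (k%:~R - m%:~R) * n%:~R
           + c * e * b * (m%:~R - n%:~R) * k%:~R
           + e * a * d * (n%:~R - k%:~R) * m%:~R)
         + a * d * f * (n%:~R - m%:~R) + c * f * b * (k%:~R - n%:~R)
         + e * b * d * (m%:~R - k%:~R)))
    (k + m + n).
Proof.
rewrite {1 2 3}/comb !(br1, br1Z, br2, br2Z, br3, br3Z).
rewrite (skew_rot sk (R k) (Q m)) (skew_rot sk (R k) (Q m) (R n)).
rewrite -(skew_rot sk (Q n) (Q k) (R m)) -(skew_rot sk (Q n) (R k) (R m)).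
rewrite !(brQQQ, brQQR, brQRR, brRRR) !(rot_add k m n) -(rot_add n k m).
by rewrite !(combZ, combD); congr comb; ring.
Qed.

Let homogE e n : H e n = comb e (e * (lam * n%:~R) + (1 - e)) n.
Proof. by rewrite /homog /comb scalerDr scalerA -addrA -scalerDl. Qed.

(** [homog] is affine in the weight, so that a scalar factor that identifies two
    weights identifies the corresponding elements. *)
Let homogZ_eq t D x y n : D * x = D * y -> (t * D) *: H x n = (t * D) *: H y n.
Proof.
move=> Dxy; rewrite !homogE !combZ -!(mulrA t).
by congr comb; rewrite ?mulrDr ?mulrN ?(mulrA D) !Dxy.
Qed.

(** The structure constants in the shifted basis; [z = 2 * lam] removes the [R]
    component from [P P R] brackets and [lam ^+ 2 = -1] kills [P P P] brackets. *)
Lemma bracket_homog (a b c : bool) k m n :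
  br (H a%:R k) (H b%:R m) (H c%:R n) =
    (q ^ (k + m + n) * weight_det a%:R k%:~R b%:R m%:~R c%:R n%:~R)
      *: H (majority a b c)%:R (k + m + n).
Proof.
rewrite !homogE bracket_comb combZ z_def !rmorphD /= /weight_det.
by case: a b c => [] [] [] /=; congr comb; ring: lam_sqr.
Qed.

Lemma bracket_homog_weight (a b c : bool) k m n :
  br (H a%:R k) (H b%:R m) (H c%:R n) =
    (q ^ (k + m + n) * weight_det a%:R k%:~R b%:R m%:~R c%:R n%:~R)
      *: H (a%:R + b%:R + c%:R - 1) (k + m + n).
Proof.
by rewrite bracket_homog; apply/homogZ_eq/weight_det_majority.
Qed.

(** Both the weight of the inner bracket and that of the outer one may be replaced
    by the additive expressions, since the inner determinant is a factor of the
    result. The exponent of [q] is twice the total degree: once from the twists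
    and the inner bracket, once from the outer bracket. *)
Lemma bracket_nested (a b c d e : bool) k l m n p :
  br (q ^ k *: H a%:R k) (q ^ l *: H b%:R l)
     (br (H c%:R m) (H d%:R n) (H e%:R p)) =
    (q ^ (k + l + m + n + p) * q ^ (k + l + m + n + p) *
       (weight_det c%:R m%:~R d%:R n%:~R e%:R p%:~R *
        weight_det a%:R k%:~R b%:R l%:~R
          (c%:R + d%:R + e%:R - 1) (m%:~R + n%:~R + p%:~R)))
      *: H (a%:R + b%:R + c%:R + d%:R + e%:R - 2) (k + l + m + n + p).
Proof.
rewrite (bracket_homog c d e) br1Z br2Z br3Z bracket_homog_weight.
have -> : k + l + (m + n + p) = k + l + m + n + p by ring.
have qS : q ^ (k + l + m + n + p) = q ^ k * q ^ l * q ^ (m + n + p).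
  by rewrite -!expfzDr //; congr (q ^ _); ring.
have := weight_det_majority c d e m%:~R n%:~R p%:~R.
rewrite !rmorphD /=; set D := weight_det c%:R _ _ _ _ _.
set M : K := (majority c d e)%:R; set s : K := c%:R + d%:R + e%:R - 1 => DM.
(* The outer determinant is affine in M, so D M = D s carries over to it. *)
have DwM : D * weight_det a%:R k%:~R b%:R l%:~R M (m%:~R + n%:~R + p%:~R) =
           D * weight_det a%:R k%:~R b%:R l%:~R s (m%:~R + n%:~R + p%:~R).
  by rewrite /weight_det [LHS]mulrDr [RHS]mulrDr (mulrA D M) (mulrA D s) DM.
rewrite -DwM; set w := weight_det _ _ _ _ _ _.
set qT := q ^ (k + l + m + n + p) in qS *.
transitivity ((qT * qT * (D * w)) *: H (a%:R + b%:R + M - 1) (k + l + m + n + p)).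
  by rewrite !scalerA {2}qS; congr (_ *: _); ring.
(* The outer weight is a + b + M - 1, again affine in M. *)
apply: homogZ_eq.
have -> : D * w * (a%:R + b%:R + M - 1) = D * w * (a%:R + b%:R - 1) + D * M * w.
  by ring.
by rewrite DM /s -/D; ring.
Qed.

(** Rotating the nested bracket into the last argument turns each term into an
    instance of [bracket_nested]. *)
Lemma Hom_Nambu_homog (a b c d e : bool) k l m n p :
  br (q ^ k *: H a%:R k) (q ^ l *: H b%:R l)
     (br (H c%:R m) (H d%:R n) (H e%:R p)) =
    br (br (H a%:R k) (H b%:R l) (H c%:R m))
       (q ^ n *: H d%:R n) (q ^ p *: H e%:R p)
  + br (q ^ m *: H c%:R m) (br (H a%:R k) (H b%:R l) (H d%:R n))
       (q ^ p *: H e%:R p)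
  + br (q ^ m *: H c%:R m) (q ^ n *: H d%:R n)
       (br (H a%:R k) (H b%:R l) (H e%:R p)).
Proof.
rewrite (skew_rot sk (br _ _ _)) -(skew_rot sk (q ^ p *: _) (q ^ m *: _)).
rewrite !bracket_nested.
have -> : n + p + k + l + m = k + l + m + n + p by ring.
have -> : p + m + k + l + n = k + l + m + n + p by ring.
have -> : m + n + k + l + p = k + l + m + n + p by ring.
rewrite !homogE !combZ !combD weight_det_Cramer.
by congr comb; ring.
Qed.

Lemma Hom_Nambu_bracket (alpha1 alpha2 : W -> W) :
  basis_family (joint_family Q R) ->
  q_twist q Q R alpha1 -> q_twist q Q R alpha2 ->
  Hom_Nambu_identity br alpha1 alpha2.
Proof.
move=> bas tw1 tw2; have [l1 _ _] := tw1; have [l2 _ _] := tw2.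
have linE := (l1, l2, br1, br2, br3).
have sumD3 t (u1 v1 u2 v2 u3 v3 : W) :
    t *: u1 + v1 + (t *: u2 + v2) + (t *: u3 + v3) =
    t *: (u1 + u2 + u3) + (v1 + v2 + v3).
  by rewrite 2!scalerDr (addrACA (t *: u1)) [LHS]addrACA.
have ext f g := @linear_eq_homog K W lam Q R f g bas.
have key (a b c d e : bool) k l m n p := Hom_Nambu_homog a b c d e k l m n p.
have tw1H e n := twist_homog (lam := lam) e n tw1.
have tw2H e n := twist_homog (lam := lam) e n tw2.
(* With the definition of the homogeneous elements visible, the linearity rules
   would unify with it and split them up again. *)
move: (homog lam Q R) ext key tw1H tw2H => h ext key tw1H tw2H x1 x2 x3 x4 x5.
move: x1; refine (ext _ _ _ _ _) => [t u v|t u v|a k].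
- by rewrite !linE.
- by rewrite !linE sumD3.
move: x2; refine (ext _ _ _ _ _) => [t u v|t u v|b l].
- by rewrite !linE.
- by rewrite !linE sumD3.
move: x3; refine (ext _ _ _ _ _) => [t u v|t u v|c m].
- by rewrite !linE.
- by rewrite !linE sumD3.
move: x4; refine (ext _ _ _ _ _) => [t u v|t u v|d n].
- by rewrite !linE.
- by rewrite !linE sumD3.
move: x5; refine (ext _ _ _ _ _) => [t u v|t u v|e p].
- by rewrite !linE.
- by rewrite !linE sumD3.
by rewrite !tw1H !tw2H key.
Qed.

End Bracket.

Theorem theorem3p2 (K : closedFieldType) (charK : [pchar K] =i pred0)
    (i : K) (i_sqr : i ^+ 2 = -1)
    (q z : K) (q_neq0 : q != 0)
    (W : lmodType K) (Q R : int -> W)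
    (basisQR : basis_family (joint_family Q R))
    (br : W -> W -> W -> W) (br_def : q_bracket q z Q R br)
    (alpha1 alpha2 : W -> W)
    (alpha1_def : q_twist q Q R alpha1) (alpha2_def : q_twist q Q R alpha2) :
  (z = 2 * i \/ z = - (2 * i)) ->
  ternary_Hom_Nambu_Lie br alpha1 alpha2.
Proof.
move=> zE.
have [lam [lam_sqr z_def]] : exists lam : K, lam ^+ 2 = -1 /\ z = 2 * lam.
  case: zE => ->; first by exists i.
  by exists (- i); rewrite sqrrN mulrN.
have [lin1 _ _] := alpha1_def; have [lin2 _ _] := alpha2_def.
split=> //; [exact: qb_trilinear br_def | exact: qb_skew br_def |].
exact: (Hom_Nambu_bracket _ _ _ _ _ _ _ _ q_neq0 lam_sqr z_def br_def).
Qed.
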